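(* Let $\Omega\subseteq\mathbb{R}^2$ be a domain of infinite width and let $u\in C^\infty(\Omega)$ with $|Du|<1$ on $\Omega$, so that its graph $\Sigma_u$ is a spacelike graph in $\mathbb{L}^3$. Suppose that $H_R=H_L$ on $\Sigma_u$ and that $\Sigma_u$ is asymptotic to a spacelike plane. Then $\Sigma_u$ is (a piece of) a spacelike plane.
   Context: A domain is a connected open set. $\mathbb{L}^3$ is $\mathbb{R}^3$ endowed with the metric $dx_1^2+dx_2^2-dx_3^2$. For $u\in C^\infty(\Omega)$, $\Sigma_u=\{(x_1,x_2,u(x_1,x_2)):(x_1,x_2)\in\Omega\}$; it is spacelike (the metric induced from $\mathbb{L}^3$ is Riemannian) if and only if $|Du|<1$, where $D$ and $|\cdot|$ are the Euclidean gradient and norm in $\mathbb{R}^2$. The mean curvature functions of a spacelike graph $\Sigma_u$ with respect to the metrics induced by $\mathbb{L}^3$ and by the Euclidean space $\mathbb{R}^3$ are $H_L=\frac12\mathrm{div}\big(Du/\sqrt{1-|Du|^2}\big)$ and $H_R=\frac12\mathrm{div}\big(Du/\sqrt{1+|Du|^2}\big)$, respectively. A spacelike plane is the graph of an affine function $\ell:\mathbb{R}^2\to\mathbb{R}$ with $|D\ell|<1$. The width of a subset of $\mathbb{R}^2$ is the supremum of the diameters of the closed discs contained in it; a domain has infinite width if it contains closed discs of any radius. For a domain $\Omega$ of infinite width, $\Sigma_u$ is asymptotic to the plane that is the graph of the affine function $\ell$ if for every $\varepsilon>0$ there exists a closed Euclidean disc $K\subset\Omega$ such that $|u(x,y)-\ell(x,y)|<\varepsilon$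 for every $(x,y)\in\Omega\setminus K$. *)

(* Defs.v *)
From HB Require Import structures.
From mathcomp Require Import all_boot all_order all_algebra.
From mathcomp Require Import all_classical all_reals all_analysis.
Import Order.TTheory GRing.Theory Num.Theory.
Import numFieldNormedType.Exports.

Set Implicit Arguments.
Unset Strict Implicit.
Unset Printing Implicit Defensive.

Local Open Scope classical_set_scope.
Local Open Scope ring_scope.

(* Points and vectors of the plane are row vectors in 'rV[R]_2.  The library
   norm on 'rV[R]_2 is the sup norm: it induces the usual topology, so [open],
   [connected], [continuous] and [derivable] are the standard notions, but the
   Euclidean length needed for gradients and discs has to be defined.
   A function on Omega is represented by a total function whose values outside
   Omega are irrelevant: Omega is open, and derivatives are local. *)

Section Plane.
Variable R : realType.

Definition enorm (v : 'rV[R]_2) : R := Num.sqrt (\sum_(i < 2) v ord0 i ^+ 2).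

Definition closed_disc (c : 'rV[R]_2) (r : R) : set 'rV[R]_2 :=
  [set p | enorm (p - c) <= r].

Definition domain (Omega : set 'rV[R]_2) : Prop :=
  open Omega /\ connected Omega.

Definition infinite_width (Omega : set 'rV[R]_2) : Prop :=
  forall r : R, 0 < r -> exists c, closed_disc c r `<=` Omega.

Definition partial (i : 'I_2) (f : 'rV[R]_2 -> R) : 'rV[R]_2 -> R :=
  fun p => 'D_(delta_mx ord0 i) f p.

Definition iter_partial (s : seq 'I_2) (f : 'rV[R]_2 -> R) : 'rV[R]_2 -> R :=
  foldr partial f s.

(* [derivable] is required explicitly because 'D_v f p is total and takes a
   default value where the directional derivative does not exist. *)
Definition smooth_on (Omega : set 'rV[R]_2) (f : 'rV[R]_2 -> R) : Prop :=
  forall (s : seq 'I_2) (p : 'rV[R]_2), Omega p ->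
    {for p, continuous (iter_partial s f)} /\
    forall i : 'I_2, derivable (iter_partial s f) p (delta_mx ord0 i).

Definition grad (f : 'rV[R]_2 -> R) (p : 'rV[R]_2) : 'rV[R]_2 :=
  \row_(i < 2) partial i f p.

Definition divergence (X : 'rV[R]_2 -> 'rV[R]_2) (p : 'rV[R]_2) : R :=
  \sum_(i < 2) partial i (fun q => X q ord0 i) p.

Definition mean_curvature_L (u : 'rV[R]_2 -> R) (p : 'rV[R]_2) : R :=
  2^-1 * divergence
    (fun q => (Num.sqrt (1 - enorm (grad u q) ^+ 2))^-1 *: grad u q) p.

Definition mean_curvature_R (u : 'rV[R]_2 -> R) (p : 'rV[R]_2) : R :=
  2^-1 * divergence
    (fun q => (Num.sqrt (1 + enorm (grad u q) ^+ 2))^-1 *: grad u q) p.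

Definition graph (Omega : set 'rV[R]_2) (u : 'rV[R]_2 -> R) :
    set ('rV[R]_2 * R) :=
  [set (p, u p) | p in Omega].

Definition affine_function (l : 'rV[R]_2 -> R) : Prop :=
  exists (a : 'rV[R]_2) (b : R),
    forall p, l p = \sum_(i < 2) a ord0 i * p ord0 i + b.

(* The graph of [l] over the whole plane is a spacelike plane. *)
Definition spacelike_affine (l : 'rV[R]_2 -> R) : Prop :=
  affine_function l /\ forall p, enorm (grad l p) < 1.

Definition asymptotic_to (Omega : set 'rV[R]_2) (u l : 'rV[R]_2 -> R) : Prop :=
  forall e : R, 0 < e ->
    exists (c : 'rV[R]_2) (r : R),
      [/\ 0 < r, closed_disc c r `<=` Omega &
          forall p, (Omega `\` closed_disc c r) p -> `|u p - l p| < e].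

End Plane.

(* Main.v *)
Require Import Defs.
From HB Require Import structures.
From mathcomp Require Import all_boot all_order all_algebra.
From mathcomp Require Import all_classical all_reals all_analysis.
From mathcomp Require Import ring lra.
Import Order.TTheory GRing.Theory Num.Theory.
Import numFieldNormedType.Exports.
Local Open Scope classical_set_scope.
Local Open Scope ring_scope.

(** The theorem is a maximum principle for the difference [u - l], where [l] is
    the affine function to which the graph is asymptotic.

    Put [S = |Du|^2], [kL = 1 / sqrt (1 - S)], [kR = 1 / sqrt (1 + S)] and
    [Q = D^2u(Du, Du)]. Expanding both divergences ([divergence_scaled]) turns
    [H_R = H_L] into
      [(kL - kR) Lap u + 2 (kL' - kR') Q = 0],
    where the primes are derivatives in [S]. When [Du <> 0] one has [kL > kR]
    and [kL' > 0 > kR'], so the equation cannot hold at a point where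
    [s Lap u < 0] and [s Q <= 0] for a number [s]
    ([equal_curvature_no_strict_sign]). The equation has no content where
    [Du = 0], and such points have to be avoided by hand.

    Fix [e > 0] and a disc [K] in [Omega] outside which [|u - l| < e], let
    [s = 1] or [s = -1], and suppose [s (u - l) > e] somewhere; that point lies
    in [K]. Add to [s (u - l)] a paraboloid [d |x - x0|^2], with [d > 0] so small
    that on [K] it is less than the excess over [e]. The sum attains its maximum
    over the compact [K] at some [q], and this is a local maximum in [Omega],
    even if [q] is on the boundary of [K], because the sum is smaller at the
    points of [Omega] that are near [K] but outside it. As [l] is affine, the second order conditions at [q] say that
    [s D^2u + 2 d I] is negative semidefinite, so that [s Lap u < 0] and
    [s Q <= 0]. The first order conditions determine [Du] at [q], and an [x0]
    chosen on the appropriate side of [K] makes [Du <> 0] there. This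
    contradicts the equation ([no_max_plus_paraboloid], [excess_le]). Hence
    [|u - l| <= e] on [Omega] for every [e > 0].

    The quadratic form [D^2u] enters through second derivatives of [u] along
    lines. These are expressed by iterated partial derivatives thanks to
    [is_derive_partials]: continuous partial derivatives give all directional
    derivatives. *)

Set Implicit Arguments.
Unset Strict Implicit.
Unset Printing Implicit Defensive.

(** * Derivatives along lines *)

(** Both sides are limits of the same difference quotient; this moves every
    question about directional derivatives to functions of one variable. *)
Lemma is_derive_line (R : realType) (V : normedModType R) (f : V -> R)
    (p v : V) (t d : R) :
  is_derive (p + t *: v) v f d <-> is_derive t 1 (fun h => f (p + h *: v)) d.
Proof.
have E : (fun h : R => h^-1 *: ((f \o shift (p + t *: v)) (h *: v)
                          - f (p + t *: v)))
       = (fun h : R => h^-1 *: (((fun k => f (p + k *: v)) \o shift t) (h *: 1)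
                          - f (p + t *: v))).
  apply/funext => h /=; congr (_ *: (f _ - _)).
  by rewrite scalerDl addrCA [h *: 1]mulr1.
split=> -[df vf]; split.
- by rewrite /derivable -E.
- by rewrite -vf /derive -E.
- by rewrite /derivable E.
- by rewrite -vf /derive E.
Qed.

Lemma is_derive_comp_scalar (R : realType) (V : normedModType R) (f : V -> R)
    (k : R -> R) (p v : V) (a b : R) :
  is_derive p v f a -> is_derive (f p) 1 k b -> is_derive p v (k \o f) (b * a).
Proof.
have p0 : p = p + 0 *: v by rewrite scale0r addr0.
rewrite {1 3}p0 => /is_derive_line Hf Hk; apply/is_derive_line.
by apply: (is_derive1_comp (f := k)); rewrite -p0.
Qed.

Lemma is_derive_line_scaled (R : realType) (V : normedModType R) (f : V -> R)
    (p v : V) (k t d : R) :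
  is_derive (p + (t * k) *: v) v f d ->
  is_derive t 1 (fun h => f (p + (h * k) *: v)) (d * k).
Proof.
move=> /is_derive_line H.
apply: (is_derive1_comp (f := fun h => f (p + h *: v)) (g := fun h => h * k)).
by apply: is_derive_eq; rewrite /GRing.scale/=; ring.
Qed.

(** The increment [k] may have either sign: the segment is parametrized by
    [0 <= t <= 1], so that no case distinction on [k] is needed. *)
Lemma mean_value_dir (R : realType) (V : normedModType R) (f df : V -> R)
    (p v : V) (k : R) :
  (forall t : R, 0 <= t <= 1 ->
     is_derive (p + (t * k) *: v) v f (df (p + (t * k) *: v))) ->
  exists2 t : R, 0 <= t <= 1 & f (p + k *: v) - f p = df (p + (t * k) *: v) * k.
Proof.
move=> H.
have Hd (t : R) : 0 <= t <= 1 -> is_derive t 1 (fun h => f (p + (h * k) *: v))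
    (df (p + (t * k) *: v) * k).
  by move=> t01; apply: is_derive_line_scaled; exact: H.
have [||c] := @MVT_segment R (fun h => f (p + (h * k) *: v))
    (fun t => df (p + (t * k) *: v) * k) 0 1 ler01.
- by move=> x; rewrite in_itv/= => /andP[x0 x1]; apply: Hd; rewrite !ltW.
- apply: derivable_within_continuous => x; rewrite in_itv/= => /Hd.
  by move=> ?; exact: ex_derive.
rewrite in_itv/= mul0r scale0r addr0 mul1r subr0 mulr1 => c01 ->.
by exists c.
Qed.

Lemma second_derivative_at_max (R : realType) (phi phi' : R -> R) (c : R) :
  (\forall t \near (0 : R), is_derive t (1 : R) phi (phi' t)) ->
  is_derive (0 : R) (1 : R) phi' c ->
  (\forall t \near (0 : R), phi t <= phi 0) ->
  phi' 0 = 0 /\ c <= 0.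
Proof.
move=> Dphi Dphi' max0.
have [e e0 He] : exists2 e : R, 0 < e & forall t : R, `|t| < e ->
    is_derive t (1 : R) phi (phi' t) /\ phi t <= phi 0.
  have /nbhs_ballP[e /= e0 He] : \forall t \near (0 : R),
      is_derive t (1 : R) phi (phi' t) /\ phi t <= phi 0.
    by near=> t; split; near: t.
  exists e => // t te; apply: He; rewrite /ball/= sub0r normrN.
  exact: te.
have phi'0 : phi' 0 = 0.
  have N0 : `|0 : R| < e by rewrite normr0.
  suff D0 : is_derive (0 : R) (1 : R) phi 0.
    by case: (He 0 N0) => -[_ <-] _; case: D0.
  apply: (@derive1_at_max R phi (- e) e 0).
  - by move: e0; lra.
  - by move=> t; rewrite in_itv/= -ltr_norml => /He[[H _] _].
  - by rewrite in_itv/= -ltr_norml.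
  - by move=> t; rewrite in_itv/= -ltr_norml => /He[].
split=> //; rewrite leNgt; apply/negP => c0.
(* Otherwise phi' is positive just to the right of its zero at 0, and the mean
   value theorem gives a value of phi larger than phi 0. *)
have [d d0 Hd] : exists2 d : R, 0 < d & forall t : R, 0 < t -> t < d -> 0 < phi' t.
  case: Dphi' => cv cE.
  have : (fun h : R => h^-1 *: ((phi' \o shift 0) (h *: 1) - phi' 0)) @ 0^' --> c.
    by rewrite -cE; exact: cv.
  move=> /cvgrPdist_lt/(_ _ c0)/nbhs_ballP[d /= d0 Hd].
  exists d => // t t0 td.
  have := Hd t; rewrite /ball/= sub0r normrN gtr0_norm// => /(_ td (lt0r_neq0 t0)).
  rewrite phi'0 subr0 [t *: 1]mulr1 addr0 /GRing.scale/= => /ltr_normlP[_].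
  rewrite ltrBlDl addrC ltrDl; rewrite pmulr_rgt0 ?invr_gt0//.
pose h := Num.min e d / 2.
have h0 : 0 < h by rewrite divr_gt0// lt_min e0 d0.
have [he hd] : h < e /\ h < d.
  have : h < Num.min e d by rewrite /h ltr_pdivrMr// mulr2n mulrDr mulr1 ltrDl lt_min e0 d0.
  by rewrite lt_min => /andP.
have He' (t : R) : 0 <= t <= h -> `|t| < e.
  by move=> /andP[t0 th]; rewrite ger0_norm// (le_lt_trans th).
have [||x] := @MVT R phi phi' 0 h h0.
- move=> x; rewrite in_itv/= => /andP[x0 xh].
  by apply: (He x _).1; apply: He'; rewrite !ltW.
- apply: derivable_within_continuous => x; rewrite in_itv/=.
  by move=> /He'/He[[H _] _].
rewrite in_itv/= subr0 => /andP[x0 xh] E.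
have : 0 < phi h - phi 0 by rewrite E mulr_gt0// Hd// (lt_trans xh).
have hh : 0 <= h <= h by rewrite lexx ltW.
have [_] := He h (He' h hh).
by move=> /[swap]; rewrite subr_gt0 ltNge => /negP.
Unshelve. all: by end_near. Qed.

(** * Coordinates in the plane *)

Lemma sum2E (V : nmodType) (F : 'I_2 -> V) : \sum_(i < 2) F i = F 0 + F 1.
Proof.
by rewrite big_ord_recl big_ord1; congr (F _ + F _); exact: val_inj.
Qed.

Lemma ord2_cases (i : 'I_2) : i = 0 \/ i = 1.
Proof. by case: i => -[|[|//]] ?; [left|right]; exact/val_inj. Qed.

Lemma rV2E (R : realType) (v : 'rV[R]_2) :
  v = v ord0 0 *: delta_mx ord0 0 + v ord0 1 *: delta_mx ord0 1.
Proof.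
apply/rowP => j; rewrite !mxE/=.
by case: (ord2_cases j) => ->; rewrite ?eqxx /= ?mulr1 ?mulr0 ?addr0 ?add0r.
Qed.

Lemma sqr_enorm (R : realType) (v : 'rV[R]_2) :
  enorm v ^+ 2 = v ord0 0 ^+ 2 + v ord0 1 ^+ 2.
Proof. by rewrite /enorm sqr_sqrtr ?sum2E// addr_ge0// sqr_ge0. Qed.

(** * Directional derivatives of smooth functions *)

(** The usual argument for functions with continuous partial derivatives: go from
    [q] to [q + h v] parallel to the axes, apply the mean value theorem on each
    of the two segments, and let the intermediate points tend to [q]. *)
Lemma is_derive_partials (R : realType) (f : 'rV[R]_2 -> R)
    (d : 'I_2 -> 'rV[R]_2 -> R) (q v : 'rV[R]_2) :
  (forall i, \forall p \near q, is_derive p (delta_mx ord0 i) f (d i p)) ->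
  (forall i, {for q, continuous (d i)}) ->
  is_derive q v f (\sum_(i < 2) v ord0 i * d i q).
Proof.
move=> Df Cd.
suff lim_quot : (fun h : R => h^-1 *: ((f \o shift q) (h *: v) - f q)) @ 0^' -->
    \sum_(i < 2) v ord0 i * d i q.
  by split; [exact: cvgP lim_quot | exact: cvg_lim lim_quot].
rewrite big_ord_recl big_ord1 (_ : lift ord0 ord0 = 1); last exact: val_inj.
set v0 := v ord0 ord0; set v1 := v ord0 1.
apply/cvgrPdist_le => e e0.
(* Bounds both |v0| and |v1|; the summand 1 makes it positive when v = 0. *)
pose M := `|v0| + `|v1| + 1.
have M0 : 0 < M by rewrite ltr_wpDl// addr_ge0.
have eM0 : 0 < e / M by rewrite divr_gt0.
have [r r0 Hr] : exists2 r : R, 0 < r & forall a b : R, `|a| < r -> `|b| < r ->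
    forall i, let p := q + a *: delta_mx ord0 0 + b *: delta_mx ord0 1 in
    is_derive p (delta_mx ord0 i) f (d i p) /\ `|d i q - d i p| < e / M.
  have /nbhs_ballP[r /= r0 Hr] : \forall p \near q, forall i,
      is_derive p (delta_mx ord0 i) f (d i p) /\ `|d i q - d i p| < e / M.
    have Hi i : \forall p \near q,
        is_derive p (delta_mx ord0 i) f (d i p) /\ `|d i q - d i p| < e / M.
      near=> p; split; first by near: p; exact: Df.
      by near: p; move: (Cd i) => /cvgrPdist_lt; exact.
    exact: filter_forall Hi.
  exists r => // a b ar br i; apply: Hr; split => // k j.
  rewrite /ball/= !mxE (ord1 k) /= -addrA opprD addNKr normrN.
  by case: (ord2_cases j) => ->;
    rewrite ?eqxx /= ?mulr1 ?mulr0 ?addr0 ?add0r.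
near=> h.
have h0 : h != 0 by near: h; exact: nbhs_dnbhs_neq.
have hM : `|h| * M < r.
  rewrite -ltr_pdivlMr//; near: h; apply: dnbhs0_lt; exact: divr_gt0.
have small (t w : R) : 0 <= t <= 1 -> `|w| <= M -> `|t * (h * w)| < r.
  move=> /andP[t0 t1] wM; rewrite !normrM (ger0_norm t0).
  apply: le_lt_trans hM; apply: le_trans (_ : 1 * (`|h| * `|w|) <= _).
    by rewrite ler_wpM2r// mulr_ge0.
  by rewrite mul1r ler_wpM2l.
have v0M : `|v0| <= M by rewrite /M -addrA lerDl addr_ge0.
have v1M : `|v1| <= M by rewrite /M addrAC lerDr addr_ge0.
have zr : `|0 : R| < r by rewrite normr0.
have [t0 t01 E0] := @mean_value_dir _ _ f (d 0) q (delta_mx ord0 0) (h * v0)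
  (fun t t01 => ltac:(by have := (Hr (t * (h * v0)) 0 (small _ _ t01 v0M) zr 0).1;
     rewrite /= scale0r addr0)).
have s1 : `|h * v0| < r by rewrite -[h * v0]mul1r small// lexx ler01.
have [t1 t11 E1] := @mean_value_dir _ _ f (d 1) (q + (h * v0) *: delta_mx ord0 0)
  (delta_mx ord0 1) (h * v1)
  (fun t t01 => (Hr (h * v0) (t * (h * v1)) s1 (small _ _ t01 v1M) 1).1).
have D0 := (Hr (t0 * (h * v0)) 0 (small _ _ t01 v0M) zr 0).2.
have D1 := (Hr (h * v0) (t1 * (h * v1)) s1 (small _ _ t11 v1M) 1).2.
move: D0 D1 E0 E1; rewrite /= scale0r addr0.
set c0 := d 0 (_ + _); set c1 := d 1 (_ + _) => D0 D1 E0 E1.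
have -> : f (h *: v + q) - f q = c1 * (h * v1) + c0 * (h * v0).
  rewrite -E1 -E0 {1}[v]rV2E [_ + q]addrC scalerDr !scalerA addrA.
  by rewrite addrA subrK.
rewrite (_ : _ *: _ = c1 * v1 + c0 * v0); last first.
  by rewrite /GRing.scale/=; field.
rewrite (_ : _ - _ = v0 * (d 0 q - c0) + v1 * (d 1 q - c1)); last by ring.
apply: le_trans (ler_normD _ _) _; rewrite !normrM.
apply: le_trans (_ : `|v0| * (e / M) + `|v1| * (e / M) <= _).
  by rewrite lerD// ler_wpM2l// ltW.
rewrite -mulrDl mulrA ler_pdivrMr// mulrC ler_pM2l//.
by rewrite /M lerDl.
Unshelve. all: by end_near. Qed.

Lemma smooth_is_derive (R : realType) (Omega : set 'rV[R]_2)
    (f : 'rV[R]_2 -> R) (s : seq 'I_2) (p v : 'rV[R]_2) :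
  open Omega -> smooth_on Omega f -> Omega p ->
  is_derive p v (iter_partial s f)
    (\sum_(i < 2) v ord0 i * iter_partial (i :: s) f p).
Proof.
move=> oO sf Op; apply: (is_derive_partials (d := fun i => iter_partial (i :: s) f)).
- move=> i; near=> x; apply: derivableP; apply: (sf s x _).2.
  by near: x; exact: open_nbhs_nbhs.
- by move=> i; exact: (sf (i :: s) p Op).1.
Unshelve. all: by end_near. Qed.

(** * The equation H_R = H_L *)

(** The chain and product rules, with [k] a function of the squared length.
    The double sum is the quadratic form of the (possibly non-symmetric)
    matrix [dg] at the vector [g p]. *)
Lemma divergence_scaled (R : realType) (g : 'rV[R]_2 -> 'rV[R]_2) (k : R -> R)
    (k' : R) (p : 'rV[R]_2) (dg : 'I_2 -> 'I_2 -> R) :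
  (forall i j, is_derive p (delta_mx ord0 i) (fun q => g q ord0 j) (dg i j)) ->
  is_derive (enorm (g p) ^+ 2) (1 : R) k k' ->
  divergence (fun q => k (enorm (g q) ^+ 2) *: g q) p =
  k (enorm (g p) ^+ 2) * (\sum_(i < 2) dg i i) +
  2 * k' * (\sum_(i < 2) \sum_(j < 2) g p ord0 i * g p ord0 j * dg i j).
Proof.
move=> Dg Dk.
have D i : is_derive p (delta_mx ord0 i)
    (fun q => (k (enorm (g q) ^+ 2) *: g q) ord0 i)
    (k (enorm (g p) ^+ 2) * dg i i + g p ord0 i *
      (k' * (2 * (g p ord0 0 * dg i 0 + g p ord0 1 * dg i 1)))).
  rewrite (_ : (fun _ => _) =
    (k \o (fun q => enorm (g q) ^+ 2)) * (fun q => g q ord0 i)); last first.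
    by apply/funext => q; rewrite mxE.
  have DS : is_derive p (delta_mx ord0 i) (fun q => enorm (g q) ^+ 2)
      (2 * (g p ord0 0 * dg i 0 + g p ord0 1 * dg i 1)).
    rewrite (_ : (fun _ => _) = (fun q => g q ord0 0) ^+ 2
                              + (fun q => g q ord0 1) ^+ 2); last first.
      by apply/funext => q; rewrite sqr_enorm.
    have D0 := Dg i 0; have D1 := Dg i 1.
    by apply: is_derive_eq; rewrite /GRing.scale/= !expr1; ring.
  have DkS := is_derive_comp_scalar DS Dk.
  have Di := Dg i i.
  by apply: is_derive_eq; rewrite /GRing.scale/=; ring.
rewrite /divergence /partial !sum2E.
have [_ ->] := D 0; have [_ ->] := D 1; ring.
Qed.

(** Only the sign of the derivative matters for the ellipticity: [c = -1] gives
    the weight in [mean_curvature_L] and [c = 1] the one in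
    [mean_curvature_R]. *)
Lemma is_derive_inv_sqrt_affine (R : realType) (c x : R) : 0 < 1 + c * x ->
  exists2 K : R, 0 < K &
    is_derive x (1 : R) (fun y => (Num.sqrt (1 + c * y))^-1) (- c * K).
Proof.
move=> h; set S := Num.sqrt (1 + c * x).
have S0 : 0 < S by rewrite sqrtr_gt0.
exists (S ^- 2 * (2 * S)^-1).
  by rewrite mulr_gt0// invr_gt0 ?exprn_gt0// mulr_gt0.
have Da : is_derive x (1 : R) (fun y => 1 + c * y) c.
  by apply: is_derive_eq; rewrite /GRing.scale/=; ring.
have Ds := is_derive1_comp (g := fun y => 1 + c * y) (is_derive1_sqrt h) Da.
have Sn0 : (Num.sqrt \o (fun y => 1 + c * y)) x != 0 by rewrite gt_eqF.
have := is_deriveV Sn0 Ds.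
rewrite /= -/S => ?.
by apply: is_derive_eq; rewrite /GRing.scale/=; ring.
Qed.

(** The two sides of the equation are [H_R] and [H_L] expanded, up to the factor
    1/2, the weights having derivatives [- KR] and [KL]. Their difference times
    [s] is [(kL - kR) (s lap)], which is negative, plus [2 (KL + KR) (s Q)],
    which is at most 0. *)
Lemma equal_curvature_no_strict_sign (R : realType) (s lap Q kL kR KL KR : R) :
  kR < kL -> 0 < KL -> 0 < KR -> s * lap < 0 -> s * Q <= 0 ->
  kR * lap + 2 * (- 1 * KR) * Q = kL * lap + 2 * (- (- 1) * KL) * Q -> False.
Proof.
move=> k KL0 KR0 sl sQ E.
have : (kL - kR) * (s * lap) + 2 * (KL + KR) * (s * Q) = 0.
  by apply/eqP; rewrite -(mulr0 s) -(subrr (kR * lap + 2 * (- 1 * KR) * Q)) {1}E; apply/eqP; ring.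
have : (kL - kR) * (s * lap) < 0 by rewrite nmulr_llt0// subr_gt0.
have : 2 * (KL + KR) * (s * Q) <= 0.
  by rewrite mulr_ge0_le0// mulr_ge0// addr_ge0// ltW.
lra.
Qed.

(** * Local maxima after adding a paraboloid *)

(** Every function [d |x - x0|^2] minus an affine function is of this form up to
    a constant, and a constant does not affect where a maximum is attained. *)
Definition paraboloid (R : realType) (m : 'rV[R]_2) (d : R) (p : 'rV[R]_2) : R :=
  \sum_(i < 2) (d * p ord0 i ^+ 2 + m ord0 i * p ord0 i).

Lemma near_line (R : realType) (q v : 'rV[R]_2) (P : set 'rV[R]_2) :
  (\forall p \near q, P p) -> \forall t \near (0 : R), P (q + t *: v).
Proof.
move=> Pq; have cq : (fun t : R => q + t *: v) @ (0 : R) --> q.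
  rewrite -[X in _ --> X]addr0 -[X in _ + X](scale0r v).
  by apply: cvgD; [exact: cvg_cst | apply: cvgZr_tmp; exact: cvg_id].
exact: cq Pq.
Qed.

(** [U] stands for [u] along a line, and the quadratic term is the paraboloid
    along that line; [is_derive_add_affine] differentiates once more, with [G0]
    and [G1] the partial derivatives of [u] along the line. *)
Lemma is_derive_add_quadratic (R : realType) (U : R -> R)
    (t dU s d q0 q1 v0 v1 m0 m1 : R) :
  is_derive t (1 : R) U dU ->
  is_derive t (1 : R) (fun h => s * U h
    + ((d * (q0 + h * v0) ^+ 2 + m0 * (q0 + h * v0))
    + (d * (q1 + h * v1) ^+ 2 + m1 * (q1 + h * v1))))
   (s * dU + (2 * d * ((q0 + t * v0) * v0 + (q1 + t * v1) * v1)
     + (m0 * v0 + m1 * v1))).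
Proof.
by move=> DU; apply: is_derive_eq; rewrite /GRing.scale/=; ring.
Qed.

Lemma is_derive_add_affine (R : realType) (G0 G1 : R -> R)
    (t g0 g1 s d q0 q1 v0 v1 m : R) :
  is_derive t (1 : R) G0 g0 -> is_derive t (1 : R) G1 g1 ->
  is_derive t (1 : R) (fun h => s * (v0 * G0 h + v1 * G1 h)
    + (2 * d * ((q0 + h * v0) * v0 + (q1 + h * v1) * v1) + m))
   (s * (v0 * g0 + v1 * g1) + 2 * d * (v0 ^+ 2 + v1 ^+ 2)).
Proof.
by move=> D0 D1; apply: is_derive_eq; rewrite /GRing.scale/=; ring.
Qed.

(** First and second order conditions at a local maximum, read off from the
    restriction to the line through [q] in direction [v]. In particular
    [s D^2u + 2 d I] is negative semidefinite at [q]. *)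
Lemma max_plus_paraboloid (R : realType) (Omega : set 'rV[R]_2)
    (u : 'rV[R]_2 -> R) (s d : R) (m q v : 'rV[R]_2) :
  open Omega -> smooth_on Omega u -> Omega q ->
  (\forall p \near q, s * u p + paraboloid m d p <= s * u q + paraboloid m d q) ->
  \sum_(i < 2) v ord0 i * (s * partial i u q + 2 * d * q ord0 i + m ord0 i) = 0
  /\ s * (\sum_(i < 2) \sum_(j < 2)
       v ord0 i * v ord0 j * partial i (partial j u) q)
     + 2 * d * (v ord0 0 ^+ 2 + v ord0 1 ^+ 2) <= 0.
Proof.
move=> oO su Oq qmax.
pose phi (t : R) := s * u (q + t *: v) + paraboloid m d (q + t *: v).
pose phi' (t : R) :=
  s * (v ord0 0 * partial 0 u (q + t *: v) + v ord0 1 * partial 1 u (q + t *: v))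
  + (2 * d * ((q ord0 0 + t * v ord0 0) * v ord0 0
              + (q ord0 1 + t * v ord0 1) * v ord0 1)
     + (m ord0 0 * v ord0 0 + m ord0 1 * v ord0 1)).
have q0 : q + 0 *: v = q by rewrite scale0r addr0.
have Dphi : \forall t \near (0 : R), is_derive t (1 : R) phi (phi' t).
  have nO : \forall t \near (0 : R), Omega (q + t *: v).
    by apply: near_line; exact: open_nbhs_nbhs.
  near=> t; have Ot : Omega (q + t *: v) by near: t.
  have /is_derive_line := smooth_is_derive [::] v oO su Ot.
  rewrite sum2E /= => Du.
  rewrite /phi (_ : (fun _ => _) = fun t => s * u (q + t *: v)
    + ((d * (q ord0 0 + t * v ord0 0) ^+ 2 + m ord0 0 * (q ord0 0 + t * v ord0 0))
    + (d * (q ord0 1 + t * v ord0 1) ^+ 2 + m ord0 1 * (q ord0 1 + t * v ord0 1)))).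
    exact: is_derive_add_quadratic Du.
  by apply/funext => h; rewrite /paraboloid sum2E !mxE.
have Dphi' : is_derive (0 : R) (1 : R) phi'
    (s * (\sum_(i < 2) \sum_(j < 2)
       v ord0 i * v ord0 j * partial i (partial j u) q)
     + 2 * d * (v ord0 0 ^+ 2 + v ord0 1 ^+ 2)).
  have D j : is_derive (0 : R) (1 : R) (fun t => partial j u (q + t *: v))
      (v ord0 0 * partial 0 (partial j u) q + v ord0 1 * partial 1 (partial j u) q).
    apply/(is_derive_line (partial j u) q v 0 _); rewrite q0.
    have := smooth_is_derive [:: j] v oO su Oq.
    by rewrite sum2E.
  have expand (h : 'I_2 -> 'I_2 -> R) :
      \sum_(i < 2) \sum_(j < 2) v ord0 i * v ord0 j * h i j =
      v ord0 0 * (v ord0 0 * h 0 0 + v ord0 1 * h 1 0)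
      + v ord0 1 * (v ord0 0 * h 0 1 + v ord0 1 * h 1 1).
    by rewrite !sum2E; ring.
  rewrite (expand (fun i j => partial i (partial j u) q)).
  exact: is_derive_add_affine (D 0) (D 1).
have mphi : \forall t \near (0 : R), phi t <= phi 0.
  rewrite /phi q0; exact: near_line qmax.
have [E H] := second_derivative_at_max Dphi Dphi' mphi.
split => //; apply: etrans E; rewrite /phi' q0 sum2E !mul0r !addr0.
by move: (partial 0 u q) (partial 1 u q) => ? ?; ring.
Unshelve. all: by end_near. Qed.

Lemma basis_quadratic (R : realType) (k : 'I_2) (h : 'I_2 -> 'I_2 -> R) :
  let v := delta_mx ord0 k : 'rV[R]_2 in
  \sum_(i < 2) \sum_(j < 2) v ord0 i * v ord0 j * h i j = h k k
  /\ v ord0 0 ^+ 2 + v ord0 1 ^+ 2 = 1.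
Proof.
by move=> v; rewrite /v; case: (ord2_cases k) => ->; rewrite !sum2E !mxE /=;
  split; ring.
Qed.

(** The coordinate directions in the second order condition give [s Lap u < 0];
    the direction [v = Du] gives [s D^2u(Du, Du) <= 0]. A nonzero gradient makes
    the equation elliptic at [q], and it then excludes these two signs. *)
Lemma no_max_plus_paraboloid (R : realType) (Omega : set 'rV[R]_2)
    (u : 'rV[R]_2 -> R) (s d : R) (m q : 'rV[R]_2) :
  open Omega -> smooth_on Omega u ->
  (forall p, Omega p -> enorm (grad u p) < 1) ->
  (forall p, Omega p -> mean_curvature_R u p = mean_curvature_L u p) ->
  0 < d -> Omega q -> (exists i, partial i u q != 0) ->
  ~ (\forall p \near q,
       s * u p + paraboloid m d p <= s * u q + paraboloid m d q).
Proof.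
move=> oO su sp eqH d0 Oq [i0 gn0] qmax.
set S := enorm (grad u q) ^+ 2.
have SE : S = partial 0 u q ^+ 2 + partial 1 u q ^+ 2.
  by rewrite /S sqr_enorm !mxE.
have S0 : 0 < S.
  have : 0 < partial i0 u q ^+ 2 by rewrite exprn_even_gt0.
  rewrite SE; case: (ord2_cases i0) => -> h; [apply: ltr_wpDr|apply: ltr_wpDl];
    by rewrite ?sqr_ge0.
have S1 : S < 1.
  by rewrite /S expr_lt1 ?sp ?sqrtr_ge0.
have Dg i j : is_derive q (delta_mx ord0 i) (fun p => grad u p ord0 j)
    (partial i (partial j u) q).
  rewrite (_ : (fun _ => _) = partial j u); last by apply/funext => p; rewrite mxE.
  by apply: derivableP; exact: (su [:: j] q Oq).2.
have pL : 0 < 1 + (- 1) * S by rewrite mulN1r subr_gt0.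
have pR : 0 < 1 + 1 * S by rewrite mul1r addr_gt0.
have [KL KL0 DL] := is_derive_inv_sqrt_affine pL.
have [KR KR0 DR] := is_derive_inv_sqrt_affine pR.
have := eqH q Oq.
rewrite /mean_curvature_R /mean_curvature_L.
have EL := divergence_scaled Dg DL; have ER := divergence_scaled Dg DR.
rewrite (_ : (fun p => (Num.sqrt (1 - _))^-1 *: _) = (fun p =>
   (Num.sqrt (1 + -1 * enorm (grad u p) ^+ 2))^-1 *: grad u p)); last first.
  by apply/funext => p; rewrite mulN1r.
rewrite (_ : (fun p => (Num.sqrt (1 + enorm _ ^+ 2))^-1 *: _) = (fun p =>
   (Num.sqrt (1 + 1 * enorm (grad u p) ^+ 2))^-1 *: grad u p)); last first.
  by apply/funext => p; rewrite mul1r.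
have h2 : (2^-1 : R) != 0 by rewrite invr_eq0.
move=> /(mulfI h2); rewrite EL ER -/S.
apply: (equal_curvature_no_strict_sign (s := s)) => //.
- by rewrite ltf_pV2 ?posrE ?sqrtr_gt0// ltr_sqrt//; lra.
- have Hk k : s * partial k (partial k u) q + 2 * d <= 0.
    have [_] := max_plus_paraboloid (delta_mx ord0 k) oO su Oq qmax.
    have [E1 E2] := basis_quadratic k (fun i j => partial i (partial j u) q).
    by rewrite E1 E2 mulr1.
  have H0 := Hk 0; have H1 := Hk 1; rewrite sum2E.
  move: (partial 0 (partial 0 u) q) (partial 1 (partial 1 u) q) H0 H1.
  by move: d0 => + h0 h1; clear; nra.
- have [_] := max_plus_paraboloid (grad u q) oO su Oq qmax.
  apply: le_trans; rewrite lerDl; apply: mulr_ge0; first by rewrite mulr_ge0// ltW.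
  by rewrite addr_ge0// sqr_ge0.
Qed.

(** * Comparison with an affine function *)

Lemma paraboloid_continuous (R : realType) (m : 'rV[R]_2) (d : R) :
  continuous (paraboloid m d).
Proof.
move=> p; rewrite /paraboloid.
have cc j : {for p, continuous (fun x : 'rV[R]_2 => x ord0 j)}.
  exact: coord_continuous.
rewrite (_ : (fun _ => _) = fun x : 'rV[R]_2 =>
  (d * (x ord0 0 * x ord0 0) + m ord0 0 * x ord0 0)
  + (d * (x ord0 1 * x ord0 1) + m ord0 1 * x ord0 1)); last first.
  by apply/funext => x; rewrite sum2E.
have term j : {for p, continuous (fun x : 'rV[R]_2 =>
    d * (x ord0 j * x ord0 j) + m ord0 j * x ord0 j)}.
  exact: cvgD (cvgM (cvg_cst d) (cvgM (cc j) (cc j)))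
              (cvgM (cvg_cst (m ord0 j)) (cc j)).
exact: cvgD (term 0) (term 1).
Qed.

Lemma sqr_dist_paraboloid (R : realType) (c x : 'rV[R]_2) :
  enorm (x - c) ^+ 2 = paraboloid (- 2 *: c) 1 x + enorm c ^+ 2.
Proof. by rewrite !sqr_enorm /paraboloid sum2E !mxE; ring. Qed.

Lemma sqr_dist_continuous (R : realType) (c : 'rV[R]_2) :
  continuous (fun x : 'rV[R]_2 => enorm (x - c) ^+ 2).
Proof.
move=> p; rewrite (_ : (fun _ => _) =
    (fun x => paraboloid (- 2 *: c) 1 x + enorm c ^+ 2)); last first.
  by apply/funext => x; rewrite sqr_dist_paraboloid.
exact: cvgD (@paraboloid_continuous _ _ _ p) (cvg_cst (enorm c ^+ 2)).
Qed.

Lemma closed_disc_sqr (R : realType) (c : 'rV[R]_2) (r : R) : 0 <= r ->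
  closed_disc c r = [set x | enorm (x - c) ^+ 2 <= r ^+ 2].
Proof.
move=> r0; apply/seteqP; split=> x /=; rewrite /closed_disc /=;
  by rewrite ler_pXn2r ?nnegrE ?sqrtr_ge0.
Qed.

Lemma closed_disc_compact (R : realType) (c : 'rV[R]_2) (r : R) : 0 <= r ->
  compact (closed_disc c r).
Proof.
move=> r0.
have boxc := @rV_compact R 2
  (fun i => `[c ord0 i - r, c ord0 i + r]%classic)
  (fun i => @segment_compact R _ _).
apply: (subclosed_compact _ boxc).
  rewrite closed_disc_sqr//.
  apply: (closed_comp (f := fun x : 'rV[R]_2 => enorm (x - c) ^+ 2)
    (D := [set y : R | y <= r ^+ 2])).
    by move=> x _; exact: sqr_dist_continuous.
  exact: closed_le.
move=> x; rewrite closed_disc_sqr//= sqr_enorm !mxE => xr i /=.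
rewrite in_itv/= -ler_distlC distrC -(ler_pXn2r (ltn0Sn 1)) ?nnegrE//.
rewrite real_normK ?num_real//.
by apply: le_trans xr; case: (ord2_cases i) => ->; rewrite ?lerDl ?lerDr sqr_ge0.
Qed.

(** One half of the maximum principle: [s = 1] bounds [u - l] from above and
    [s = -1] from below. The bound [e] holds outside a closed disc contained in
    [Omega], and it propagates to the disc. *)
Lemma excess_le (R : realType) (Omega : set 'rV[R]_2) (u : 'rV[R]_2 -> R)
    (s b e r : R) (a c : 'rV[R]_2) :
  open Omega -> smooth_on Omega u ->
  (forall p, Omega p -> enorm (grad u p) < 1) ->
  (forall p, Omega p -> mean_curvature_R u p = mean_curvature_L u p) ->
  0 < r -> closed_disc c r `<=` Omega ->
  (forall p, (Omega `\` closed_disc c r) p ->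
     s * (u p - (\sum_(i < 2) a ord0 i * p ord0 i + b)) < e) ->
  forall p, Omega p ->
     s * (u p - (\sum_(i < 2) a ord0 i * p ord0 i + b)) <= e.
Proof.
move=> oO su sp eqH r0 dO; pose w x :=
  s * (u x - (\sum_(i < 2) a ord0 i * x ord0 i + b)).
rewrite -/w => wout p Op; rewrite -/(w p) leNgt; apply/negP => wp.
have pd : closed_disc c r p.
  apply: contrapT => npd; have : w p < e by apply: wout.
  by rewrite ltNge (ltW wp).
have r2 : 0 < 16 * r ^+ 2 by rewrite mulr_gt0// exprn_gt0.
(* On the disc |x - x0| is at most 3 r, as |c - x0| = 2 r. The constant
   16 > 9 keeps d |x - x0|^2 <= w p - e in a neighbourhood of the disc. *)
pose d := (w p - e) / (16 * r ^+ 2).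
have d0 : 0 < d by rewrite divr_gt0// subr_gt0.
have dE : d * (16 * r ^+ 2) = w p - e by rewrite /d mulfVK// gt_eqF.
(* The sign makes x0 lie on the side of the disc for which both terms of
   s a_0 + 2 d (x0 - q)_0, the value of s (Du)_0 at the maximum q, have the same
   sign; the second one is nonzero because x0 is beyond the disc. *)
pose sg : R := if 0 <= s * a ord0 0 then 1 else - 1.
pose x0 : 'rV[R]_2 := c + (2 * sg * r) *: delta_mx ord0 0.
pose m := (- 2 * d) *: x0 - s *: a.
pose G x := s * u x + paraboloid m d x.
have GE x : G x = w x + d * enorm (x - x0) ^+ 2 + (s * b - d * enorm x0 ^+ 2).
  rewrite /G /w !sqr_enorm /paraboloid !sum2E /m !mxE.
  by move: (u x) => ?; ring.
have [q qd qmax] : exists2 q, q \in closed_disc c r &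
    forall t, t \in closed_disc c r -> G t <= G q.
  apply: compact_EVT_max; [by exists p| exact/closed_disc_compact/ltW|].
  apply: continuous_in_subspaceT => x /set_mem/dO Ox.
  exact: cvgD (cvgM (cvg_cst s) (su [::] x Ox).1)
              (@paraboloid_continuous _ m d x).
move/set_mem: qd => qd; have Oq := dO _ qd.
have qc : (q ord0 0 - c ord0 0) ^+ 2 + (q ord0 1 - c ord0 1) ^+ 2 <= r ^+ 2.
  by move: qd; rewrite (closed_disc_sqr _ (ltW r0))/= sqr_enorm !mxE.
have q0r : `|q ord0 0 - c ord0 0| <= r.
  rewrite -(ler_pXn2r (ltn0Sn 1)) ?nnegrE ?(ltW r0)// real_normK ?num_real//.
  by apply: le_trans qc; rewrite lerDl sqr_ge0.
have sg1 : sg = 1 \/ sg = -1 by rewrite /sg; case: ifP => _; [left|right].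
have qx0 : enorm (q - x0) ^+ 2 < 16 * r ^+ 2.
  rewrite sqr_enorm !mxE /= mulr1 mulr0 addr0.
  have /ler_normlP[q1 q2] := q0r.
  by case: sg1 => ->; nra.
have near_max : \forall x \near q, G x <= G q.
  have nO : \forall x \near q, Omega x by exact: open_nbhs_nbhs.
  have nN : \forall x \near q, enorm (x - x0) ^+ 2 < 16 * r ^+ 2.
    exact: (cvgr_lt _ (@sqr_dist_continuous _ x0 q)) _ qx0.
  (* q may lie on the boundary of the disc, so points outside matter too. *)
  near=> x; have [xd|xd] := pselect (closed_disc c r x).
    by apply: qmax; exact/mem_set.
  apply: le_trans (qmax p (mem_set pd)); rewrite !GE lerD2r.
  have wx : w x < e by apply: wout; split => //; near: x.
  have Nx : enorm (x - x0) ^+ 2 < 16 * r ^+ 2 by near: x.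
  have : d * enorm (x - x0) ^+ 2 <= w p - e by rewrite -dE ler_pM2l// ltW.
  have : 0 <= d * enorm (p - x0) ^+ 2 by rewrite mulr_ge0 ?sqr_ge0// ltW.
  move: wx; move: (w x) (w p) (d * _) (d * _) => ? ? ? ?; lra.
apply: (no_max_plus_paraboloid oO su sp eqH d0 Oq _ near_max).
exists 0; apply/eqP => g0.
have [+ _] := max_plus_paraboloid (delta_mx ord0 0) oO su Oq near_max.
rewrite sum2E g0 !mxE /= !(mulr0, mul0r, addr0, mul1r, add0r, mulr1).
have /ler_normlP[q1 q2] := q0r.
rewrite /sg; case: ifP => [sa|/negbT]; last rewrite -ltNge => sa; move=> E; nra.
Unshelve. all: by end_near. Qed.

Unset Implicit Arguments.

Theorem theorem6 (R : realType) (Omega : set 'rV[R]_2) (u : 'rV[R]_2 -> R)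
    (dom_Omega : domain Omega)
    (width_Omega : infinite_width Omega)
    (smooth_u : smooth_on Omega u)
    (spacelike_u : forall p, Omega p -> enorm (grad u p) < 1)
    (eq_H : forall p, Omega p -> mean_curvature_R u p = mean_curvature_L u p)
    (asymptotic_u : exists2 l, spacelike_affine l & asymptotic_to Omega u l) :
  exists2 l, spacelike_affine l & graph Omega u `<=` graph setT l.
Proof.
have [l lspace asym] := asymptotic_u; exists l => //.
have [[a [b lE]] _] := lspace; have [oO _] := dom_Omega.
move=> _ [p Op <-]; exists p => //; congr (_, _).
apply/esym/eqP; rewrite -subr_eq0 -normr_le0.
apply/ler_addgt0Pr => e e0; rewrite add0r.
have [c [r [r0 dO out]]] := asym e e0.
have bound s : `|s| = 1 -> s * (u p - l p) <= e.
  move=> s1; rewrite lE.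
  apply: (excess_le oO smooth_u spacelike_u eq_H r0 dO _ Op) => x /out.
  rewrite -lE; apply: le_lt_trans.
  by rewrite (le_trans (ler_norm _))// normrM s1 mul1r.
have := bound 1 (normr1 _); have := bound (- 1) (normrN1 _).
by rewrite mulN1r mul1r ler_norml => + ->; rewrite andbT lerNl.
Qed.
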